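(* Let $N\ge 2$, and let $q_j\in(0,1)$ and $\gamma_j\in(0,1)$ for $j\in\mathcal N=\{1,\dots,N\}$ be the update generation probabilities and the transmission success probabilities of the $N$ sources in the discrete-time multi-source Ber/Geo/1/1 preemptive status updating system (described in the context). Fix $i\in\mathcal N$, and set $$p=1-\prod_{j=1}^N(1-q_j),\qquad p_i=\sum_{h=0}^{N-1}\ \sum_{\substack{\mathcal H\subset\mathcal N\setminus\{i\}\\ |\mathcal H|=h}}\frac{q_i\prod_{j\in\mathcal H}q_j}{h+1}\prod_{l\in\mathcal N\setminus(\mathcal H\cup\{i\})}(1-q_l),\qquad \lambda_i=(1-\gamma_i)(1-p).$$ Let $\alpha_i$ and $\beta_i$ be the two different solutions of the quadratic equation $x^2-(1-\gamma_ip_i+\lambda_i)x+\lambda_i=0$ in $x$. Then the stationary probability mass function $\pi_i(n)=\Pr\{\Delta_i=n\}$ and the average $\overline\Delta_i=\mathbb E[\Delta_i]=\sum_{n=2}^\infty n\,\pi_i(n)$ of the age of information (AoI) of source $i$ are $$\pi_i(n)=\gamma_ip_i\,\frac{\beta_i^{\,n-1}-\alpha_i^{\,n-1}}{\beta_i-\alpha_i},\quad n\ge 2,\qquad\text{and}\qquad \overline\Delta_i=\frac{\gamma_i+(1-\gamma_i)p}{\gamma_ip_i}+1.$$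
   Context: System. Time is divided into slots $t=1,2,\dots$. There are $N$ sources and one bufferless transmitter that holds at most one update. At the end of each slot, source $j$ generates an update with probability $q_j$, independently over sources and slots; an update generated at the end of slot $U$ has time stamp $U$. Each transmission attempt occupies one slot (it starts at the beginning of the slot and completes right before its end), and an attempt for a source-$j$ update succeeds with probability $\gamma_j$, independently of everything else. If at least one update is generated at the end of a slot, one of the newly generated updates is selected uniformly at random and is transmitted starting in the next slot, replacing (preempting) any update whose transmission has just failed; unselected updates are discarded. If no update is generated at the end of a slot, then the transmitter retransmits the current update in the next slot if its transmission failed, and is idle in the next slot if the transmission succeeded (or if it was already idle). Consequently $p_i$ is the probability that a source-$i$ update is generated and selected at the end of a given slot, and $p=\sum_{j=1}^N p_j$ is the probability that at least one update is generated. AoI. $\Delta_i(t)=t-U_i(t)$, where $U_i(t)$ is the time stamp of the latest source-$i$ update successfully received as of slot $t$ (i.e. before the transmission of slot $t$ completes). The minimum possible value is $2$. 2D age process. $\boldsymbol\Delta_i(t)=(\Delta_i(t),\Delta_i'(t))$, where $\Delta_i'(t)=0$ if no source-$i$ update is being transmitted in slot $t$ (transmitter idle or serving another source), and otherwise $\Delta_i'(t)\ge1$ is the current age ($t$ minus its time stamp) of the source-$i$ update being transmitted. This is a discrete-time Markov chain on $\mathcal S=\{(n,m)\in\mathbb Z^2: n\ge2,\ 0\le m<n\}$ with one-step transition probabilities as follows. For $n\ge3$: from $(n-1,0)$ to $(n,1)$ with probability $p_i$, and to $(n,0)$ with probability $1-p_i$. For $n>m\ge2$: from $(n-1,m-1)$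 to $(m,1)$ with probability $\gamma_ip_i$; to $(m,0)$ with probability $\gamma_i(1-p_i)$; to $(n,1)$ with probability $(1-\gamma_i)p_i$; to $(n,0)$ with probability $(1-\gamma_i)(p-p_i)$; to $(n,m)$ with probability $(1-\gamma_i)(1-p)$ (probabilities of coinciding target states are added). Stationary regime. The process is considered in its stationary regime: with $\pi^{(i)}_{(n,m)}$ the stationary distribution of this chain (the probability distribution on $\mathcal S$ invariant under the transitions), the stationary p.m.f. of the AoI is its first marginal, $\pi_i(n)=\Pr\{\Delta_i=n\}=\sum_{m=0}^{n-1}\pi^{(i)}_{(n,m)}$ for $n\ge2$. *)

(* Defs.v *)
From HB Require Import structures.
From mathcomp Require Import all_boot all_order all_algebra.
From mathcomp Require Import all_classical all_reals all_analysis.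

Set Implicit Arguments.
Unset Strict Implicit.
Unset Printing Implicit Defensive.

Import Order.TTheory GRing.Theory Num.Theory.
Local Open Scope ring_scope.

(* Sources are indexed by 'I_N, i.e. 0, ..., N-1 instead of 1, ..., N. *)

Definition gen_prob (R : realType) (N : nat) (q : 'I_N -> R) : R :=
  1 - \prod_(j < N) (1 - q j).

(* H is the set of the other sources that generate an update in the slot; the
   update of source i is then selected with probability 1 / (#|H| + 1). *)
Definition sel_prob (R : realType) (N : nat) (q : 'I_N -> R) (i : 'I_N) : R :=
  \sum_(h < N)
    \sum_(H : {set 'I_N} | (H \subset [set: 'I_N] :\ i) && (#|H| == h))
      (q i * \prod_(j in H) q j) / h.+1%:R
        * \prod_(l | l \notin H :|: [set i]) (1 - q l).

(* A state is a pair (n, m): n is the AoI, m is the age of the source-i update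
   in transmission, and m = 0 if there is none. *)
Definition age_states : set (nat * nat) :=
  [set s : nat * nat | (2 <= s.1)%N /\ (s.2 < s.1)%N]%classic.

(* A boolean (t == _) is used as its indicator in {0, 1}: summing the weighted
   indicators adds up the probabilities of coinciding targets. *)
Definition age_trans (R : realType) (g p ps : R) (s t : nat * nat) : R :=
  let: (a, b) := s in
  if b == 0%N then
    ps * (t == (a.+1, 1%N))%:R + (1 - ps) * (t == (a.+1, 0%N))%:R
  else
    g * ps * (t == (b.+1, 1%N))%:R
    + g * (1 - ps) * (t == (b.+1, 0%N))%:R
    + (1 - g) * ps * (t == (a.+1, 1%N))%:R
    + (1 - g) * (p - ps) * (t == (a.+1, 0%N))%:R
    + (1 - g) * (1 - p) * (t == (a.+1, b.+1))%:R.

(* A distribution on S is a function on the ambient type T extended by 0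
   outside S, so that two distributions on S are equal iff the functions are. *)
Definition stationary_distribution (R : realType) (T : choiceType)
    (S : set T) (P : T -> T -> R) (mu : T -> R) : Prop :=
  [/\ forall s, 0 <= mu s,
      forall s, ~ S s -> mu s = 0,
      (\esum_(s in S) (mu s)%:E = 1)%E
    & forall t, S t -> (\esum_(s in S) (mu s * P s t)%:E = (mu t)%:E)%E].

Definition aoi_pmf (R : realType) (mu : nat * nat -> R) (n : nat) : R :=
  \sum_(m < n) mu (n, val m).

(* The series has nonnegative terms for the nonnegative mu of interest, so it
   has a value in [0, +oo]. *)
Definition aoi_mean (R : realType) (mu : nat * nat -> R) : \bar R :=
  (\sum_(2 <= n <oo) (n%:R * aoi_pmf mu n)%:E)%E.

(* Main.v *)
(* Fix a source, write g, p, ps for its gamma_i, p, p_i, and lam = (1 - g)(1 - p).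
   In a stationary distribution mu the column m + 1 is lam times the column m,
   shifted along the diagonal, so only the mass c of the column m = 1 is unknown
   in the inflow from successful transmissions.  Given c, the balance equations
   become a recursion for a n = Pr (AoI = n + 1) and for the part b n of it with
   m >= 1:
     a (n + 1) = a n - g b n + g c lam^n,  b (n + 1) = ps a (n + 1) + lam b n.
   Telescoping the first equation bounds sum b, then the second gives
   sum a = c / ps, so normalization forces c = ps: this yields both existence and
   uniqueness.  Eliminating b leaves
   a (n + 2) = (1 - g ps + lam) a (n + 1) - lam a n, hence the closed form; the
   mean follows by telescoping the same two equations with weights n + 1. *)
Require Import Defs.
From HB Require Import structures.
From mathcomp Require Import all_boot all_order all_algebra.
From mathcomp Require Import all_classical all_reals all_analysis.
From mathcomp Require Import ring lra zify.

Set Implicit Arguments.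
Unset Strict Implicit.
Unset Printing Implicit Defensive.

Import Order.TTheory GRing.Theory Num.Theory.
Import numFieldNormedType.Exports.
Local Open Scope classical_set_scope.
Local Open Scope ring_scope.

(** * Bounds on the selection and generation probabilities *)

(** Expand the product of the [F j + G j], all equal to 1; since [F i = 0], the sets containing [i]
    drop out. *)
Lemma sum_prod_setD1 (R : realType) (N : nat) (q : 'I_N -> R) (i : 'I_N) :
  \sum_(H : {set 'I_N} | H \subset [set: 'I_N] :\ i)
    (\prod_(j in H) q j * \prod_(l | l \notin H :|: [set i]) (1 - q l)) = 1.
Proof.
pose F j := if j == i then 0 else q j.
pose G j := if j == i then 1 else 1 - q j.
have FG1 : \prod_j (F j + G j) = 1.
  by apply: big1 => j _; rewrite /F /G; case: eqP => _; ring.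
rewrite -[RHS]FG1 bigA_distr.
rewrite [RHS](bigID (fun H : {set 'I_N} => H \subset [set: 'I_N] :\ i)) /=.
rewrite [X in _ = _ + X]big1 ?addr0; last first.
  move=> H; rewrite finset.subsetD1 finset.subsetT /= negbK => iH.
  by rewrite (bigD1 i) //= iH /F eqxx mul0r.
apply: eq_bigr => H; rewrite finset.subsetD1 finset.subsetT /= => iH.
rewrite [RHS](bigID (fun j => j \in H)) /=; congr (_ * _).
  apply: eq_bigr => j jH; rewrite jH /F; case: eqP => // ji.
  by move: iH; rewrite -ji jH.
rewrite [RHS](bigID (fun j => j == i)) /= [X in _ = X * _]big1 ?mul1r.
  apply: eq_big => j; first by rewrite !inE negb_or.
  by rewrite !inE negb_or => /andP[/negbTE -> /negbTE ji]; rewrite /G ji.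
by move=> j /andP[/negbTE -> /eqP ->]; rewrite /G eqxx.
Qed.

(** Bounding each 1/(h+1) by 1 leaves [q i] times the total probability 1 of the sets [H]. *)
Lemma sel_prob_le (R : realType) (N : nat) (q : 'I_N -> R) (i : 'I_N) :
  (forall j, 0 < q j < 1) -> sel_prob q i <= q i.
Proof.
move=> hq; have q0 j : 0 <= q j by case/andP: (hq j) => /ltW.
have q1 j : 0 <= 1 - q j by rewrite subr_ge0; case/andP: (hq j) => _ /ltW.
(* Each [H] occurs for the single index h = #|H|, so the double sum collapses to a sum over [H]. *)
rewrite /sel_prob (exchange_big_dep (fun H : {set 'I_N} => H \subset [set: 'I_N] :\ i)) /=;
  last by move=> h H _ /andP[].
rewrite -[leRHS]mulr1 -[X in _ * X](sum_prod_setD1 q i) mulr_sumr; apply: ler_sum => H Hi.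
have HN : (#|H| < N)%N.
  by rewrite -[X in (_ < X)%N]card_ord -cardsT; apply: proper_card;
    apply: sub_proper_trans Hi (properD1 (finset.in_setT i)).
rewrite (big_pred1 (Ordinal HN)) /=; last first.
  by move=> h; rewrite Hi /= -val_eqE /= eq_sym.
rewrite [leRHS]mulrA ler_wpM2r ?prodr_ge0 // ler_pdivrMr ?ltr0Sn //.
by rewrite ler_peMr ?ler1n // mulr_ge0 ?prodr_ge0.
Qed.

Lemma sel_prob_gt0 (R : realType) (N : nat) (q : 'I_N -> R) (i : 'I_N) :
  (forall j, 0 < q j < 1) -> 0 < sel_prob q i.
Proof.
move=> hq; have q0 j : 0 < q j by case/andP: (hq j).
have q1 j : 0 < 1 - q j by rewrite subr_gt0; case/andP: (hq j).
have T0 (h : nat) (H : {set 'I_N}) : 0 < (q i * \prod_(j in H) q j) / h.+1%:R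
        * \prod_(l | l \notin H :|: [set i]) (1 - q l).
  by rewrite !(mulr_gt0, divr_gt0, prodr_gt0, ltr0Sn).
have N0 : (0 < N)%N by case: N i {q hq q0 q1 T0} => // -[].
rewrite /sel_prob (bigD1 (Ordinal N0)) //= ltr_wpDr //.
  by apply: sumr_ge0 => h _; apply: sumr_ge0 => H _; exact: ltW.
rewrite (bigD1 finset.set0) /=; last by rewrite finset.sub0set cards0.
by rewrite ltr_wpDr //; apply: sumr_ge0 => H _; exact: ltW.
Qed.

Lemma gen_prob_lt1 (R : realType) (N : nat) (q : 'I_N -> R) :
  (forall j, 0 < q j < 1) -> gen_prob q < 1.
Proof.
move=> hq; rewrite /gen_prob ltrBlDr ltrDl prodr_gt0 // => j _.
by rewrite subr_gt0; case/andP: (hq j).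
Qed.

(** A second source [k] gives [(1 - q k) * P < 1], hence the strict inequality. This strictness
    later separates the characteristic roots. *)
Lemma gen_prob_gt (R : realType) (N : nat) (q : 'I_N -> R) (i : 'I_N) :
  (2 <= N)%N -> (forall j, 0 < q j < 1) -> q i < gen_prob q.
Proof.
move=> hN hq; have q1 j : 0 < 1 - q j <= 1.
  by case/andP: (hq j) => *; lra.
have [k ki] : exists k, k != i.
  apply/existsP; rewrite -negb_forall; apply/negP => /forallP iall.
  suff : (#|'I_N| <= 1)%N by rewrite card_ord leqNgt hN.
  apply/fintype_le1P => x y.
  by move: (iall x) (iall y) => /eqP -> /eqP ->.
rewrite /gen_prob (bigD1 i) //= (bigD1 k) //=.
set P := \prod_(_ < _ | _) _.
have P0 : 0 <= P by apply: prodr_ge0 => j _; case/andP: (q1 j) => /ltW.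
have P1 : P <= 1.
  by apply: Num.Theory.prodr_ile1 => j _; case/andP: (q1 j) => /ltW -> ->.
have [/andP[qi0 qi1] /andP[qk0 qk1]] := (hq i, hq k).
have : (1 - q k) * P < 1 by nra.
nra.
Qed.

(** * Summing the age recursion, without and with the weights n + 1 *)

Section age_recursion.
Context {R : realType}.
Implicit Types (a b u : R^nat).

Lemma bounded_series_is_cvg u M :
  (forall n, 0 <= u n) -> (forall n, series u n <= M) -> cvgn (series u).
Proof.
move=> u0 uM; apply: nondecreasing_is_cvgn.
  by apply: nondecreasing_series => n _ _; exact: u0.
by exists M => _ [n _ <-]; exact: uM.
Qed.

Lemma series_le_cvg u l n :
  (forall n, 0 <= u n) -> series u @ \oo --> l -> series u n <= l.
Proof.
move=> u0 ul; rewrite -(cvg_lim (@Rhausdorff R) ul).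
apply: nondecreasing_cvgn_le; last by apply/cvg_ex; exists l.
by apply: nondecreasing_series => k _ _; exact: u0.
Qed.

Lemma series_natmul_exp (z : R) n :
  (1 - z) ^+ 2 * series (fun k => k.+1%:R * z ^+ k) n
  = 1 - n.+1%:R * z ^+ n * (1 - z) - z ^+ n.+1.
Proof.
elim: n => [|n IH]; first by rewrite seriesEnat /= big_nil; ring.
by rewrite seriesSr mulrDr IH !exprS -!natr1; ring.
Qed.

(** The closed form serves twice: it first bounds the partial sums, so the series converges and its
    term [w n] tends to 0; it then yields the limit. *)
Lemma cvg_series_natmul_exp (z : R) : 0 <= z < 1 ->
  series (fun k => k.+1%:R * z ^+ k) @ \oo --> (1 - z) ^- 2.
Proof.
move=> /andP[z0 z1]; have nz : 1 - z != 0 by lra.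
have E := series_natmul_exp z; set w := fun k => _ in E *.
have w0 n : 0 <= w n by rewrite mulr_ge0 ?exprn_ge0.
have cw : cvgn (series w).
  apply: (@bounded_series_is_cvg _ ((1 - z) ^- 2)) => // n.
  rewrite -(ler_pM2l (_ : 0 < (1 - z) ^+ 2)) ?exprn_gt0 ?subr_gt0 // E.
  rewrite divff ?expf_neq0 // -addrA gerDl -opprD oppr_le0.
  by rewrite addr_ge0 ?exprn_ge0 // mulr_ge0 ?mulr_ge0 ?exprn_ge0 // subr_ge0 ltW.
have w_0 := cvg_series_cvg_0 cw.
have z_0 : (fun n => z ^+ n) @ \oo --> 0 by apply: cvg_expr; rewrite ger0_norm.
have -> : series w = fun n => (1 - z) ^- 2 * (1 - w n * (1 - z) - z ^+ n.+1).
  by apply/funext => n; rewrite -E mulKf ?expf_neq0.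
rewrite [X in _ --> X](_ : _ = (1 - z) ^- 2 * (1 - 0 * (1 - z) - 0)); last first.
  by rewrite mul0r !subr0 mulr1.
apply: cvgMl_tmp; apply: cvgB; last by rewrite (cvg_shiftS (fun n => z ^+ n)).
by apply: cvgB; [exact: cvg_cst|apply: cvgMr_tmp].
Qed.

Variables (g c ps lam : R) (a b : R^nat).
Hypotheses (g0 : 0 < g) (c0 : 0 <= c) (ps0 : 0 < ps) (lam01 : 0 < lam < 1).
Hypotheses (a0 : a 0%N = 0) (b0 : b 0%N = 0).
Hypothesis aS : forall n, a n.+1 = a n - g * b n + g * c * lam ^+ n.
Hypothesis bS : forall n, b n.+1 = ps * a n.+1 + lam * b n.
Hypotheses (a_ge0 : forall n, 0 <= a n) (b_ge0 : forall n, 0 <= b n).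

Let lam_gt0 : 0 < lam. Proof. by case/andP: lam01. Qed.
Let lam_lt1 : lam < 1. Proof. by case/andP: lam01. Qed.

(** Telescoping of [aS]. Since [a n >= 0], it bounds the partial sums of [b]. *)
Let aE n : a n = g * (c * series (geometric 1 lam) n - series b n).
Proof.
elim: n => [|n IH]; first by rewrite a0 !seriesEnat /= !big_nil; ring.
by rewrite aS {1}IH !seriesSr /=; ring.
Qed.

Let series_b n : series b n.+1 = ps * series a n.+1 + lam * series b n.
Proof.
elim: n => [|n IH].
  by rewrite !seriesEnat /= !big_nil !big_nat1 a0 b0; ring.
by rewrite seriesSr bS {1}IH !(seriesSr _ n) (seriesSr _ n.+1) !(seriesSr _ n);
  ring.
Qed.

Let ps_le n : ps * a n <= b n.
Proof.
by case: n => [|n]; rewrite ?a0 ?b0 ?mulr0 // bS lerDl mulr_ge0 // ltW.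
Qed.

Let cvg_geo : series (geometric 1 lam) @ \oo --> 1 / (1 - lam).
Proof. by apply: cvg_geometric_series; rewrite gtr0_norm. Qed.

(** [aE] makes [series b] converge, and [series_b] transfers this to [series a]. Then [a] tends to
    0, and the limits of [aE] and [series_b] give both values. *)
Let cvg_b : series b @ \oo --> c / (1 - lam) /\ series a @ \oo --> c / ps.
Proof.
have nlam : 1 - lam != 0 by rewrite subr_eq0 gt_eqF.
have nps : ps != 0 by rewrite gt_eqF.
have cb : cvgn (series b).
  apply: (@bounded_series_is_cvg _ (c * (1 / (1 - lam)))) => // n.
  have : 0 <= c * series (geometric 1 lam) n - series b n.
    by rewrite -(pmulr_rge0 _ g0) -aE.
  rewrite subr_ge0 => /le_trans; apply.
  by rewrite ler_wpM2l // geometric_le_lim ?ltW // gtr0_norm.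
pose sb := limn (series b).
have ca : series a @ \oo --> (1 - lam) * sb / ps.
  rewrite -(cvg_shiftS (series a)) /=.
  have -> : (fun n => series a n.+1) =
            (fun n => (series b n.+1 - lam * series b n) / ps).
    by apply/funext => n; rewrite series_b; field.
  apply: cvgMr_tmp; rewrite mulrBl mul1r.
  by apply: cvgB; [rewrite (cvg_shiftS (series b))|apply: cvgMl_tmp].
have a_0 : a @ \oo --> 0 by apply: cvg_series_cvg_0; apply/cvg_ex; eexists; exact: ca.
(* The limit of [aE] must agree with the limit 0 of [a], which determines [sb]. *)
have sbE : sb = c / (1 - lam).
  have : a @ \oo --> g * (c * (1 / (1 - lam)) - sb).
    rewrite (funext aE); apply: cvgMl_tmp; apply: cvgB => //.
    exact: cvgMl_tmp.
  move/(cvg_unique (@Rhausdorff R) a_0)/esym/eqP.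
  rewrite mulf_eq0 gt_eqF //= subr_eq0 => /eqP <-; by rewrite mul1r.
split; first by rewrite -sbE.
rewrite [X in _ --> X](_ : _ = (1 - lam) * sb / ps) // sbE.
by field; rewrite nlam nps.
Qed.

Lemma cvg_series_age : series a @ \oo --> c / ps.
Proof. by case: cvg_b. Qed.

Let u := fun k => k.+1%:R * b k.
Let v := fun k => k.+1%:R * a k.
Let w := fun k => k.+1%:R * lam ^+ k.

Let series_u n : series u n.+1 = ps * series v n.+1 + lam * (series u n + series b n).
Proof.
elim: n => [|n IH].
  by rewrite !seriesEnat /= !big_nil !big_nat1 /u /v a0 b0; ring.
rewrite seriesSr {1}IH (seriesSr v n.+1) (seriesSr u n) (seriesSr b n).
by rewrite /u /v bS -!natr1; ring.
Qed.

(** The increment of n a(n) is a(n) plus n + 1 times the increment of a, so [aS] telescopes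
    again. *)
Let nata n : n%:R * a n = series a n - g * series u n + g * c * series w n.
Proof.
elim: n => [|n IH]; first by rewrite !seriesEnat /= !big_nil; ring.
rewrite aS !(seriesSr _ n) /u /w.
rewrite [LHS](_ : _ = n%:R * a n + a n - n.+1%:R * g * b n
   + n.+1%:R * g * c * lam ^+ n); last by rewrite -natr1; ring.
by rewrite IH; ring.
Qed.

(** Same scheme as for [cvg_b]: [nata] bounds [series u], its limit then fixes [su], and [series_u]
    converts this into the sum of [v]. *)
Lemma cvg_series_natmul_age :
  series (fun k => k.+1%:R * a k) @ \oo
    --> c * ((1 - lam) / (g * ps ^+ 2) + 1 / ps).
Proof.
have nlam : 1 - lam != 0 by rewrite subr_eq0 gt_eqF.
have nps : ps != 0 by rewrite gt_eqF.
have ng : g != 0 by rewrite gt_eqF.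
have [cb ca] := cvg_b.
have cw : series w @ \oo --> (1 - lam) ^- 2.
  by apply: cvg_series_natmul_exp; rewrite ltW.
have w_ge0 n : 0 <= w n by rewrite mulr_ge0 // exprn_ge0 // ltW.
have u_ge0 n : 0 <= u n by rewrite mulr_ge0.
have cu : cvgn (series u).
  apply: (@bounded_series_is_cvg _ ((c / ps + g * c * (1 - lam) ^- 2) / g)) => // n.
  rewrite ler_pdivlMr // mulrC.
  have -> : g * series u n = series a n + g * c * series w n - n%:R * a n.
    by rewrite nata; ring.
  rewrite lerBlDr -[leLHS]addr0 lerD ?mulr_ge0 // lerD ?series_le_cvg //.
  by rewrite ler_wpM2l ?series_le_cvg // mulr_ge0 // ltW.
pose su := limn (series u).
have u_0 := cvg_series_cvg_0 cu.
have a_0 : a @ \oo --> 0 by apply: cvg_series_cvg_0; apply/cvg_ex; eexists; exact: ca.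
(* By [ps_le], ps n a(n) <= n b(n) <= u(n), and the terms of the convergent [series u] tend to 0. *)
have na_0 : (fun n => n%:R * a n) @ \oo --> 0.
  apply: (@squeeze_cvgr _ _ _ _ (fun=> 0) (fun n => u n / ps)); last 2 first.
  - exact: cvg_cst.
  - by rewrite -[X in _ --> X](mul0r ps^-1); apply: cvgMr_tmp.
  near=> n; rewrite mulr_ge0 //= ler_pdivlMr // /u -natr1.
  have := ps_le n; have := b_ge0 n; have := ler0n R n; nra.
have suE : g * su = c / ps + g * c * (1 - lam) ^- 2.
  have : (fun n => n%:R * a n) @ \oo --> c / ps - g * su + g * c * (1 - lam) ^- 2.
    rewrite (funext nata); apply: cvgD; last exact: cvgMl_tmp.
    by apply: cvgB => //; apply: cvgMl_tmp.
  move/(cvg_unique (@Rhausdorff R) na_0) => ?; lra.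
rewrite -(cvg_shiftS (series _)) /=.
have -> : (fun n => series (fun k => k.+1%:R * a k) n.+1) =
          (fun n => (series u n.+1 - lam * (series u n + series b n)) / ps).
  by apply/funext => n; rewrite series_u -/v; field.
have -> : c * ((1 - lam) / (g * ps ^+ 2) + 1 / ps)
    = (su - lam * (su + c / (1 - lam))) / ps.
  have -> : su = (c / ps + g * c * (1 - lam) ^- 2) / g by rewrite -suE mulrC mulKf.
  by field; rewrite nlam nps ng.
apply: cvgMr_tmp; apply: cvgB; first by rewrite (cvg_shiftS (series u)).
by apply: cvgMl_tmp; apply: cvgD.
Unshelve. all: by end_near. Qed.

End age_recursion.

(** * Sums over the state space by rows, columns and points *)

Section sums_over_age_states.
Context {R : realType}.
Implicit Types (f mu : nat * nat -> R).

(** Used to trade [age_states] for an explicitly enumerated set that differs from it only where the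
    summand vanishes. *)
Lemma eq_esum_support (T : choiceType) (A B : set T) (F : T -> \bar R) :
  (forall s, A s -> ~ B s -> F s = 0%E) ->
  (forall s, B s -> ~ A s -> F s = 0%E) ->
  \esum_(s in A) F s = \esum_(s in B) F s.
Proof.
move=> AB BA; rewrite esum_mkcond [RHS]esum_mkcond; apply: eq_esum => s _.
case: ifPn; case: ifPn; rewrite !(inE, notin_setE) //.
  by move=> nB A'; exact: AB.
by move=> B' nA; apply/esym/BA.
Qed.

Lemma esum_age_states f :
  (forall s, 0 <= f s) -> (forall s, ~ age_states s -> f s = 0) ->
  (\esum_(s in age_states) (f s)%:E
   = \sum_(0 <= n <oo) (\sum_(b < n) f (n, val b))%:E)%E.
Proof.
move=> f0 fS.
rewrite (@eq_esum_support _ _ ([set: nat] `*`` (fun n => `I_n))); first last.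
- by move=> s _ /fS ->.
- by move=> [n b] [_ /= bn] []; split.
transitivity (\esum_(k in [set: nat] `*`` (fun n => `I_n)) (f (k.1, k.2))%:E)%E.
  by apply: eq_esum => -[].
rewrite -(esum_esum (a := fun n b => (f (n, b))%:E)); last first.
  by move=> n b _ _; rewrite lee_fin.
rewrite nneseries_esumT; last by move=> n; rewrite lee_fin sumr_ge0.
apply: eq_esum => n _; rewrite esum_fset //; last by move=> b _; rewrite lee_fin.
by rewrite -fsbig_ord -sumEFin.
Qed.

Lemma esum_age_row f n :
  (forall s, 0 <= f s) -> (forall s, ~ age_states s -> f s = 0) ->
  (\esum_(s in age_states) (f s * (s.1 == n)%:R)%:E
   = (\sum_(b < n) f (n, val b))%:E)%E.
Proof.
move=> f0 fS; have inj : set_inj `I_n (pair n) by move=> x y _ _ [].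
rewrite (@eq_esum_support _ _ (pair n @` `I_n)); first last.
- by move=> s _ /fS ->; rewrite mul0r.
- move=> [a b] [/= _ ba] nI; case: eqP => [an|_]; last by rewrite mulr0.
  by case: nI; exists b; rewrite ?an //= -an.
rewrite (esum_image _ _ _ inj) esum_fset //; last first.
  by move=> b _; rewrite lee_fin mulr_ge0.
rewrite -fsbig_ord -sumEFin; apply: eq_bigr => b _.
by rewrite eqxx mulr1.
Qed.

(** As m < n for every state, the column m = k + 1 starts at age k + 2. *)
Lemma esum_age_col f k :
  (forall s, 0 <= f s) -> (forall s, ~ age_states s -> f s = 0) ->
  (\esum_(s in age_states) (f s * (s.2 == k.+1)%:R)%:E
   = \sum_(0 <= j <oo) (f (k.+2 + j, k.+1)%N)%:E)%E.
Proof.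
move=> f0 fS; pose e j := ((k.+2 + j)%N, k.+1).
have inj : set_inj [set: nat] e by move=> x y _ _ []; lia.
rewrite (@eq_esum_support _ _ (e @` [set: nat])); first last.
- by move=> s _ /fS ->; rewrite mul0r.
- move=> [a b] [/= _ ba] nI; case: eqP => [bk|_]; last by rewrite mulr0.
  case: nI; exists (a - k.+2)%N => //; rewrite /e bk; congr pair; lia.
rewrite (esum_image _ _ _ inj) -nneseries_esumT; last first.
  by move=> j; rewrite lee_fin mulr_ge0.
by apply: eq_eseriesr => j _; rewrite eqxx mulr1.
Qed.

Lemma esum_age_point f s0 :
  (forall s, 0 <= f s) -> (forall s, ~ age_states s -> f s = 0) ->
  (\esum_(s in age_states) (f s * (s == s0)%:R)%:E = (f s0)%:E)%E.
Proof.
move=> f0 fS.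
rewrite (@eq_esum_support _ _ [set s0]); first last.
- by move=> s _ /fS ->; rewrite mul0r.
- by move=> s _ /= /eqP/negbTE ->; rewrite mulr0.
by rewrite esum_set1 ?lee_fin ?mulr_ge0 // eqxx mulr1.
Qed.

Lemma nneseries_EFin (x : R^nat) l :
  series x @ \oo --> l -> (\sum_(0 <= n <oo) (x n)%:E = l%:E)%E.
Proof.
move=> xl; apply: cvg_lim => //.
rewrite [X in X @ _ --> _](_ : _ = EFin \o series x).
  by apply: cvg_EFin; [exact: nearW|exact: xl].
by apply/funext => n; rewrite /= seriesEnat /= sumEFin.
Qed.

Lemma cvg_seriesS (x : R^nat) (l : R) :
  x 0%N = 0 ->
  (series (fun n => x n.+1) @ \oo --> l) <-> (series x @ \oo --> l).
Proof.
move=> x0; rewrite -(cvg_shiftS (series x)) /=.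
suff -> : series (fun n => x n.+1) = (fun n => series x n.+1) by [].
apply/funext => n; rewrite !seriesEnat /= big_nat_recl // x0 add0r.
by [].
Qed.

End sums_over_age_states.

(** * The age chain: inflow into each kind of state *)

Section age_chain.
Context {R : realType}.
Variables g p ps : R.
Hypotheses (g01 : 0 < g < 1) (ps0 : 0 < ps) (psp : ps < p) (p1 : p < 1).
Implicit Types (mu : nat * nat -> R) (c : R).

Let lam := (1 - g) * (1 - p).
Let stationary := stationary_distribution age_states (age_trans g p ps).

Let g_gt0 : 0 < g. Proof. by case/andP: g01. Qed.
Let g_lt1 : g < 1. Proof. by case/andP: g01. Qed.
Let lam01 : 0 < lam < 1.
Proof.
have p0 := lt_trans ps0 psp.
by rewrite mulr_gt0 ?mulr_ilt1 ?subr_ge0 ?subr_gt0 ?gtrBl ?ltW.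
Qed.
Let g_ge0 : 0 <= g. Proof. exact: ltW. Qed.
Let ps_ge0 : 0 <= ps. Proof. exact: ltW. Qed.
Let onem_g_ge0 : 0 <= 1 - g. Proof. by rewrite subr_ge0 ltW. Qed.
Let onem_ps_ge0 : 0 <= 1 - ps. Proof. by rewrite subr_ge0 ltW // (lt_trans psp). Qed.
Let p_ps_ge0 : 0 <= p - ps. Proof. by rewrite subr_ge0 ltW. Qed.
Let lam_ge0 : 0 <= lam. Proof. by case/andP: lam01 => /ltW. Qed.

(** Extended-real valued, because for an arbitrary stationary [mu] finiteness is only derived later,
    from the total mass 1. *)
Definition column_mass mu k : \bar R :=
  (\sum_(0 <= j <oo) (mu (k.+2 + j, k.+1)%N)%:E)%E.

(** Common form of the inflow into (n+2, 0) and (n+2, 1): row n + 1 feeds them when the AoI grows by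
    one, with weight [x0] from m = 0 and [x1] otherwise; column n + 1 feeds them after a success,
    with weight [y]. *)
Lemma age_inflow mu (P : nat * nat -> R) (x0 x1 y : R) n :
  (forall s, 0 <= mu s) -> (forall s, ~ age_states s -> mu s = 0) ->
  0 <= x0 -> 0 <= x1 -> 0 <= y ->
  (forall s, P s = (if s.2 == 0%N then x0 else x1) * (s.1 == n.+1)%:R
                   + y * (s.2 == n.+1)%:R) ->
  (\esum_(s in age_states) (mu s * P s)%:E
   = (x0 * mu (n.+1, 0%N) + x1 * \sum_(m < n) mu (n.+1, m.+1))%:E
     + y%:E * column_mass mu n)%E.
Proof.
move=> mu0 muS x00 x10 y0 PE.
pose f s := mu s * (if s.2 == 0%N then x0 else x1).
have f0 s : 0 <= f s by rewrite mulr_ge0 //; case: ifP.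
have fS s : ~ age_states s -> f s = 0 by move=> /muS; rewrite /f => ->; rewrite mul0r.
pose h s := y * mu s.
have h0 s : 0 <= h s by rewrite mulr_ge0.
have hS s : ~ age_states s -> h s = 0 by move=> /muS; rewrite /h => ->; rewrite mulr0.
transitivity (\esum_(s in age_states) ((f s * (s.1 == n.+1)%:R)%:E
                + (h s * (s.2 == n.+1)%:R)%:E))%E.
  apply: eq_esum => s _; rewrite PE -EFinD; congr EFin.
  by rewrite /f /h; ring.
rewrite esumD; last 2 first.
- by move=> s _; rewrite lee_fin mulr_ge0.
- by move=> s _; rewrite lee_fin mulr_ge0.
rewrite esum_age_row // esum_age_col //; congr (_ + _)%E.
  congr EFin; rewrite big_ord_recl /f /= mulrC; congr (_ + _).
  by rewrite mulr_sumr; apply: eq_bigr => m _; rewrite /= mulrC.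
rewrite -nneseriesZl; last by move=> j _; rewrite lee_fin.
by apply: eq_eseriesr => j _; rewrite -EFinM.
Qed.

Lemma age_inflow0 mu n :
  (forall s, 0 <= mu s) -> (forall s, ~ age_states s -> mu s = 0) ->
  (\esum_(s in age_states) (mu s * age_trans g p ps s (n.+2, 0%N))%:E
   = ((1 - ps) * mu (n.+1, 0%N)
      + (1 - g) * (p - ps) * \sum_(m < n) mu (n.+1, m.+1))%:E
     + (g * (1 - ps))%:E * column_mass mu n)%E.
Proof.
move=> mu0 muS; apply: age_inflow; rewrite ?mulr_ge0 //.
by move=> [a [|b]]; rewrite /age_trans /= !xpair_eqE !eqSS /= ?andbF ?andbT
  ![n.+1 == _]eq_sym ?[n == _]eq_sym ?mulr0n; ring.
Qed.

Lemma age_inflow1 mu n :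
  (forall s, 0 <= mu s) -> (forall s, ~ age_states s -> mu s = 0) ->
  (\esum_(s in age_states) (mu s * age_trans g p ps s (n.+2, 1%N))%:E
   = (ps * mu (n.+1, 0%N)
      + (1 - g) * ps * \sum_(m < n) mu (n.+1, m.+1))%:E
     + (g * ps)%:E * column_mass mu n)%E.
Proof.
move=> mu0 muS; apply: age_inflow; rewrite ?mulr_ge0 //.
by move=> [a [|b]]; rewrite /age_trans /= !xpair_eqE !eqSS /= ?andbF ?andbT
  ![n.+1 == _]eq_sym ?[n == _]eq_sym ?mulr0n; ring.
Qed.

(** An in-service age of at least 2 arises only from a failure followed by a retransmission, hence
    from the diagonal predecessor alone. *)
Lemma age_inflowS mu n m :
  (forall s, 0 <= mu s) -> (forall s, ~ age_states s -> mu s = 0) ->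
  (\esum_(s in age_states) (mu s * age_trans g p ps s (n.+2, m.+2))%:E
   = (lam * mu (n.+1, m.+1))%:E)%E.
Proof.
move=> mu0 muS; pose f s := lam * mu s.
rewrite -[RHS](@esum_age_point _ f (n.+1, m.+1)); last 2 first.
- by move=> s; rewrite mulr_ge0.
- by move=> s /muS; rewrite /f => ->; rewrite mulr0.
apply: eq_esum => -[a [|b]] _; congr EFin;
  rewrite /age_trans /f /= !xpair_eqE !eqSS /= ?andbF ?mulr0n; first by ring.
by rewrite [a == _]eq_sym [b == _]eq_sym /lam; ring.
Qed.

(** * An explicit family of solutions of the balance equations *)

(* [age_rec c n] is the pair (mu (n+1, 0), sum of mu (n+1, m) over m >= 1) for
   a solution mu of the balance equations whose column m = 1 has mass c. *)
Fixpoint age_rec c n : R * R :=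
  if n is k.+1 then
    let: (x, y) := age_rec c k in
    ((1 - ps) * x + (1 - g) * (p - ps) * y + g * (1 - ps) * c * lam ^+ k,
     ps * (x + (1 - g) * y + g * c * lam ^+ k) + lam * y)
  else (0, 0).

(** The mass at AoI n + 1; the offset makes the recursion start from the empty row 0. *)
Definition age_row c n : R := (age_rec c n).1 + (age_rec c n).2.

(** A state with in-service age m + 1 descends along its diagonal from column 1, at a factor [lam]
    per step; column 1 carries the fraction [ps] of each row. For m >= n the truncated subtraction
    gives [age_row c 0 = 0]. *)
Definition age_sol c (s : nat * nat) : R :=
  if s.2 is m.+1 then lam ^+ m * (ps * age_row c (s.1 - s.2)%N)
  else (age_rec c s.1.-1).1.

(** The weights of [y] add up to (1 - g)(p - ps) + (1 - g) ps + lam = 1 - g. *)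
Lemma age_rec_rowS c n :
  age_row c n.+1 = age_row c n - g * (age_rec c n).2 + g * c * lam ^+ n.
Proof. by rewrite /age_row /=; case: (age_rec c n) => x y /=; rewrite /lam; ring. Qed.

Lemma age_rec_busyS c n :
  (age_rec c n.+1).2 = ps * age_row c n.+1 + lam * (age_rec c n).2.
Proof. by rewrite /age_row /=; case: (age_rec c n) => x y /=; rewrite /lam; ring. Qed.

Lemma age_row0 c : age_row c 0 = 0.
Proof. by rewrite /age_row /= addr0. Qed.

Lemma age_rec_ge0 c n :
  0 <= c -> 0 <= (age_rec c n).1 /\ 0 <= (age_rec c n).2.
Proof.
move=> c0; elim: n => [//|n] /=; case: (age_rec c n) => x y /= [x0 y0].
by split; rewrite !(lam_ge0, onem_g_ge0, onem_ps_ge0, p_ps_ge0, exprn_ge0, mulr_ge0, addr_ge0).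
Qed.

Lemma age_row_ge0 c n : 0 <= c -> 0 <= age_row c n.
Proof. by move=> /(age_rec_ge0 n) [x y]; rewrite addr_ge0. Qed.

Lemma age_sol_ge0 c s : 0 <= c -> 0 <= age_sol c s.
Proof.
move=> c0; case: s => a [|b]; rewrite /age_sol /=; first by case: (age_rec_ge0 a.-1 c0).
by rewrite !mulr_ge0 ?exprn_ge0 ?age_row_ge0 // ltW.
Qed.

Lemma age_sol_out c s : ~ age_states s -> age_sol c s = 0.
Proof.
case: s => a [|b]; rewrite /age_states /age_sol /= => nS.
  by case: a nS => [|[|a]] //= [].
rewrite (_ : (a - b.+1)%N = 0%N) ?age_row0 ?mulr0 //; apply/eqP.
rewrite subn_eq0 leqNgt; apply/negP => ba; apply: nS; split => //.
by apply: leq_trans ba.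
Qed.

(** The entry m = 1 is the new term of [age_rec_busyS]; the others are the previous row, shifted and
    scaled by [lam]. *)
Lemma sum_age_sol_row c n :
  \sum_(m < n) age_sol c (n.+1, m.+1) = (age_rec c n).2.
Proof.
elim: n => [|n IH]; first by rewrite big_ord0.
rewrite big_ord_recl age_rec_busyS -IH mulr_sumr.
congr (_ + _); first by rewrite /age_sol /= expr0 mul1r subSS subn0.
by apply: eq_bigr => m _; rewrite /age_sol /= exprS subSS mulrA.
Qed.

Lemma aoi_pmf_age_sol c n : aoi_pmf (age_sol c) n = age_row c n.-1.
Proof.
rewrite /aoi_pmf; case: n => [|n]; first by rewrite big_ord0 age_row0.
by rewrite big_ord_recl [X in _ + X]sum_age_sol_row.
Qed.

Lemma cvg_series_age_row c : 0 <= c -> series (age_row c) @ \oo --> c / ps.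
Proof.
move=> c0; apply: (cvg_series_age (b := fun n => (age_rec c n).2) g_gt0 c0 ps0 lam01) => //.
- exact: age_row0.
- exact: age_rec_rowS.
- exact: age_rec_busyS.
- by move=> n; exact: age_row_ge0.
- by move=> n; case: (age_rec_ge0 n c0).
Qed.

Lemma cvg_series_natmul_age_row c : 0 <= c ->
  series (fun n => n.+1%:R * age_row c n) @ \oo
    --> c * ((1 - lam) / (g * ps ^+ 2) + 1 / ps).
Proof.
move=> c0.
apply: (cvg_series_natmul_age (b := fun n => (age_rec c n).2) g_gt0 c0 ps0 lam01) => //.
- exact: age_row0.
- exact: age_rec_rowS.
- exact: age_rec_busyS.
- by move=> n; exact: age_row_ge0.
- by move=> n; case: (age_rec_ge0 n c0).
Qed.

(** Consistency of the ansatz: for k = 0, the assumed mass [c] of column 1 is recovered from the sum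
    [c / ps] of the rows. *)
Lemma column_mass_age_sol c k : 0 <= c ->
  column_mass (age_sol c) k = (lam ^+ k * c)%:E.
Proof.
move=> c0; apply: nneseries_EFin.
have -> : (fun j => age_sol c (k.+2 + j, k.+1)%N)
          = (fun j => lam ^+ k * ps * age_row c j.+1).
  apply/funext => j; rewrite /age_sol /= mulrA.
  by rewrite addSnnS addKn.
apply/(@cvg_seriesS _ (fun j => lam ^+ k * ps * age_row c j)).
  by rewrite age_row0 mulr0.
have -> : series (fun j => lam ^+ k * ps * age_row c j)
          = (fun n => lam ^+ k * ps * series (age_row c) n).
  by apply/funext => n; rewrite !seriesEnat /= mulr_sumr.
have -> : lam ^+ k * c = lam ^+ k * ps * (c / ps).
  by field; rewrite gt_eqF.
by apply: cvgMl_tmp; exact: cvg_series_age_row.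
Qed.

Lemma esum_age_sol c : 0 <= c ->
  (\esum_(s in age_states) (age_sol c s)%:E = (c / ps)%:E)%E.
Proof.
move=> c0; rewrite esum_age_states; last 2 first.
- by move=> s; exact: age_sol_ge0.
- by move=> s; exact: age_sol_out.
apply: nneseries_EFin; apply/cvg_seriesS; first by rewrite big_ord0.
rewrite [X in series X](_ : _ = age_row c); first exact: cvg_series_age_row.
by apply/funext => n; exact: (aoi_pmf_age_sol c n.+1).
Qed.

(** * Existence and uniqueness of the stationary distribution *)

Lemma stationary_age_sol : stationary (age_sol ps).
Proof.
have c0 := ltW ps0; have mu0 s := @age_sol_ge0 _ s c0.
have muS := @age_sol_out ps.
split => //; first by rewrite esum_age_sol // divff // gt_eqF.
move=> [[|[|n]] m] [] //= _ _; case: m => [|[|m]].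
- rewrite age_inflow0 // sum_age_sol_row column_mass_age_sol // -EFinM -EFinD.
  congr EFin; rewrite /age_sol /=; case: (age_rec ps n) => x y /=; ring.
- rewrite age_inflow1 // sum_age_sol_row column_mass_age_sol // -EFinM -EFinD.
  congr EFin; rewrite /age_sol /= expr0 subn1 /= age_rec_rowS /age_row.
  by case: (age_rec ps n) => x y /=; ring.
- rewrite age_inflowS //; congr EFin.
  by rewrite /age_sol /= exprS subSS mulrA.
Qed.

Lemma stationary_eq_age_sol mu : stationary mu -> mu = age_sol ps.
Proof.
move=> [mu0 muS mu1 mueq].
(* The mass of column 1 is at most the total mass 1, hence a real number. *)
have [c c0 cE] : exists2 c, 0 <= c & column_mass mu 0 = c%:E.
  have col0 : (0 <= column_mass mu 0)%E by apply: nneseries_ge0 => j _ _; rewrite lee_fin.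
  have col1 : (column_mass mu 0 <= 1)%E.
    rewrite -mu1 -[column_mass _ _](@esum_age_col _ mu 0) //; apply: le_esum => s _.
    by rewrite lee_fin ler_piMr // lern1 leq_b1.
  case: (column_mass mu 0) col0 col1 => [c| |] // c0 _.
  by exists c.
(* Balance at the states with m >= 2 multiplies the column mass by [lam] at each step. *)
have colE k : column_mass mu k = (lam ^+ k * c)%:E.
  elim: k => [|k IH]; first by rewrite cE expr0 mul1r.
  rewrite exprS -mulrA EFinM -IH -nneseriesZl; last by move=> j _; rewrite lee_fin.
  apply: eq_eseriesr => j _; rewrite -EFinM !addSn -age_inflowS // mueq //.
  by split => //=; rewrite !ltnS leq_addr.
(* Induction on the row: with the column masses known, balance determines row n + 2 from row n + 1.
   Rows 0 and 1 contain no state. *)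
have muE n m : mu (n, m) = age_sol c (n, m).
  elim: n m => [|[|n] IH] m.
  - by rewrite muS ?age_sol_out // => -[].
  - by rewrite muS ?age_sol_out // => -[].
  have [nm|mn] := leqP n.+2 m.
    by rewrite muS ?age_sol_out // => -[_ /=]; rewrite ltnNge nm.
  apply: EFin_inj; rewrite -mueq //.
  have rowE : \sum_(m < n) mu (n.+1, m.+1) = (age_rec c n).2.
    by rewrite -sum_age_sol_row; apply: eq_bigr => k _; exact: IH.
  case: m mn => [|[|m]] mn.
  - rewrite age_inflow0 // rowE IH colE // -EFinM -EFinD.
    congr EFin; rewrite /age_sol /=; case: (age_rec c n) => x y /=; ring.
  - rewrite age_inflow1 // rowE IH colE // -EFinM -EFinD.
    congr EFin; rewrite /age_sol /= expr0 subn1 /= age_rec_rowS /age_row.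
    by case: (age_rec c n) => x y /=; ring.
  - rewrite age_inflowS // IH; congr EFin.
    by rewrite /age_sol /= exprS subSS mulrA.
(* Normalization now reads c / ps = 1. *)
have {}muE : mu = age_sol c by apply/funext => -[n m].
move: mu1; rewrite muE esum_age_sol // => -[cps].
by rewrite -[c](divfK (negbT (gt_eqF ps0))) cps mul1r.
Qed.

(** * Closed form and mean of the AoI *)

(** Both sides satisfy the second-order recurrence with this characteristic equation and start with
    0 and g c; the induction carries two consecutive values. *)
Lemma age_row_closed alpha beta c n : alpha != beta ->
  alpha ^+ 2 - (1 - g * ps + lam) * alpha + lam = 0 ->
  beta ^+ 2 - (1 - g * ps + lam) * beta + lam = 0 ->
  age_row c n = g * c * ((beta ^+ n - alpha ^+ n) / (beta - alpha)).
Proof.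
move=> ab sa sb; have nab : beta - alpha != 0 by rewrite subr_eq0 eq_sym.
suff [] : age_row c n = g * c * ((beta ^+ n - alpha ^+ n) / (beta - alpha)) /\
  age_row c n.+1 = g * c * ((beta ^+ n.+1 - alpha ^+ n.+1) / (beta - alpha)) by [].
elim: n => [|n [IH0 IH1]].
  rewrite age_rec_rowS age_row0 /= !expr0 !expr1; split; field => //.
split => //; have -> : age_row c n.+2
    = (1 - g * ps + lam) * age_row c n.+1 - lam * age_row c n.
  rewrite age_rec_rowS age_rec_busyS exprS.
  (* Adding and subtracting [age_row c n] exposes the right side of [age_rec_rowS], which eliminates
     the busy part. *)
  rewrite [LHS](_ : _ = age_row c n.+1 - g * ps * age_row c n.+1
    + lam * (age_row c n - g * (age_rec c n).2 + g * c * lam ^+ n - age_row c n));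
    last by ring.
  by rewrite -age_rec_rowS; ring.
have E x : x ^+ 2 - (1 - g * ps + lam) * x + lam = 0 ->
    x ^+ n.+2 = (1 - g * ps + lam) * x ^+ n.+1 - lam * x ^+ n.
  move=> sx; rewrite (_ : x ^+ n.+2 = (x ^+ 2 - (1 - g * ps + lam) * x + lam) * x ^+ n
    + (1 - g * ps + lam) * x ^+ n.+1 - lam * x ^+ n); last by rewrite !exprS; ring.
  by rewrite sx; ring.
by rewrite IH0 IH1 !E //; field.
Qed.

Lemma aoi_mean_age_sol :
  aoi_mean (age_sol ps) = ((g + (1 - g) * p) / (g * ps) + 1)%:E.
Proof.
have c0 := ltW ps0; rewrite /aoi_mean.
pose x n := n%:R * aoi_pmf (age_sol ps) n.
have x0 n : 0 <= x n by rewrite mulr_ge0 // aoi_pmf_age_sol age_row_ge0.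
transitivity (\sum_(0 <= n <oo) (x n)%:E)%E.
  (* The terms n = 0 and n = 1 vanish, so the sum may start at 0. *)
  rewrite [RHS](nneseries_split 0 2) => [|n _]; last by rewrite lee_fin.
  rewrite add0n big_nat_recr //= big_nat1 /x !aoi_pmf_age_sol /= !age_row0.
  by rewrite !mulr0 !add0e.
apply: nneseries_EFin; apply/cvg_seriesS; first by rewrite /x mul0r.
(* The weighted sum at c = ps, using 1 - lam = g + (1 - g) p. *)
have -> : (g + (1 - g) * p) / (g * ps) + 1
    = ps * ((1 - lam) / (g * ps ^+ 2) + 1 / ps).
  by rewrite /lam; field; rewrite !gt_eqF.
have -> : (fun n => x n.+1) = (fun n => n.+1%:R * age_row ps n).
  by apply/funext => n; rewrite /x aoi_pmf_age_sol.
exact: cvg_series_natmul_age_row.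
Qed.

Lemma characteristic_roots : exists alpha beta : R,
  [/\ alpha != beta,
      alpha ^+ 2 - (1 - g * ps + lam) * alpha + lam = 0 &
      beta ^+ 2 - (1 - g * ps + lam) * beta + lam = 0].
Proof.
set s := 1 - g * ps + lam.
(* With [u = 1 - g] and [v = 1 - p], [s > u + v] because [ps < p], whereas
   [lam = u v]; so the discriminant exceeds [(u - v)^2]. *)
have d0 : 0 < s ^+ 2 - 4 * lam.
  have s1 : (1 - g) + (1 - p) < s.
    rewrite -subr_gt0 (_ : _ - _ = g * (p - ps)); first by rewrite mulr_gt0 ?subr_gt0.
    by rewrite /s /lam; ring.
  apply: (@le_lt_trans _ _ (((1 - g) - (1 - p)) ^+ 2)); first exact: sqr_ge0.
  rewrite [ltLHS](_ : _ = ((1 - g) + (1 - p)) ^+ 2 - 4 * lam); last by rewrite /lam; ring.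
  have uv0 : 0 <= (1 - g) + (1 - p) by rewrite addr_ge0 // subr_ge0 ltW.
  by rewrite ltrD2r ltrXn2r ?nnegrE //; exact: le_trans uv0 (ltW s1).
pose r := Num.sqrt (s ^+ 2 - 4 * lam).
have r0 : 0 < r by rewrite sqrtr_gt0.
have rE : r ^+ 2 = s ^+ 2 - 4 * lam by rewrite sqr_sqrtr // ltW.
exists ((s - r) / 2), ((s + r) / 2); split; first by rewrite lt_eqF //; lra.
  by rewrite [LHS](_ : _ = (r ^+ 2 - (s ^+ 2 - 4 * lam)) / 4); [rewrite rE; ring|field].
by rewrite [LHS](_ : _ = (r ^+ 2 - (s ^+ 2 - 4 * lam)) / 4); [rewrite rE; ring|field].
Qed.

End age_chain.

Theorem theorem1 (R : realType) (N : nat) (q gamma : 'I_N -> R) (i : 'I_N)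
    (hN : (2 <= N)%N)
    (hq : forall j, 0 < q j < 1)
    (hgamma : forall j, 0 < gamma j < 1) :
  let p := gen_prob q in
  let p_i := sel_prob q i in
  let g_i := gamma i in
  let lambda_i := (1 - g_i) * (1 - p) in
  let sol (x : R) := x ^+ 2 - (1 - g_i * p_i + lambda_i) * x + lambda_i = 0 in
  let stationary := stationary_distribution age_states (age_trans g_i p p_i) in
  [/\ exists alpha beta : R, [/\ alpha != beta, sol alpha & sol beta],
      exists! mu : nat * nat -> R, stationary mu
    & forall (alpha beta : R) (mu : nat * nat -> R),
        alpha != beta -> sol alpha -> sol beta -> stationary mu ->
        (forall n : nat, (2 <= n)%N ->
           aoi_pmf mu n
           = g_i * p_i * ((beta ^+ n.-1 - alpha ^+ n.-1) / (beta - alpha)))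
        /\ aoi_mean mu = ((g_i + (1 - g_i) * p) / (g_i * p_i) + 1)%:E].
Proof.
move=> p p_i g_i lambda_i sol stationary.
have g01 : 0 < g_i < 1 := hgamma i.
have ps0 : 0 < p_i := sel_prob_gt0 i hq.
(* [q i] lies between the two: p_i <= q_i < p. *)
have psp : p_i < p := le_lt_trans (sel_prob_le i hq) (gen_prob_gt i hN hq).
have p1 : p < 1 := gen_prob_lt1 hq.
split; first exact: characteristic_roots.
  exists (age_sol g_i p p_i p_i); split; first exact: stationary_age_sol.
  by move=> mu /stationary_eq_age_sol => /(_ g01 ps0 psp p1) ->.
move=> alpha beta mu ab sa sb.
move=> /stationary_eq_age_sol => /(_ g01 ps0 psp p1) ->; split.
  by move=> n _; rewrite aoi_pmf_age_sol; exact: age_row_closed.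
exact: aoi_mean_age_sol.
Qed.
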